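(* Let $(X,\circ,\backslash_{\circ},\bullet,/_{\bullet})$ be a distributive birack with $X\neq\emptyset$ and let $k\geq 2$ be an integer. Then the following conditions are equivalent: (i) $|\mathrm{Ret}^k(X)|=1$; (ii) $(X,\circ,\backslash_{\circ},\bullet,/_{\bullet})$ is $k$-reductive; (iii) $(X,\circ,\backslash_{\circ},\bullet,/_{\bullet})$ is $k$-permutational; (iv) the group $\mathrm{Mlt}(X)$ is nilpotent of class at most $k-1$.
   Context: A birack is a set $X$ with four binary operations $\circ,\backslash_{\circ},\bullet,/_{\bullet}$ such that for all $x,y,z\in X$: $x\circ(x\backslash_{\circ} y)=y=x\backslash_{\circ}(x\circ y)$; $(y/_{\bullet}x)\bullet x=y=(y\bullet x)/_{\bullet}x$; $x\circ(y\circ z)=(x\circ y)\circ((x\bullet y)\circ z)$; $(x\circ y)\bullet((x\bullet y)\circ z)=(x\bullet(y\circ z))\circ(y\bullet z)$; $(x\bullet y)\bullet z=(x\bullet(y\circ z))\bullet(y\bullet z)$. Write $L_x(a)=x\circ a$ and $\mathbf{R}_x(a)=a\bullet x$; these are bijections of $X$. $\mathrm{Mlt}(X)$ is the permutation group generated by all $L_x$ and $\mathbf{R}_x$, $x\in X$. The birack is left distributive if $x\circ(y\circ z)=(x\circ y)\circ(x\circ z)$ for all $x,y,z$, right distributive if $(y\bullet z)\bullet x=(y\bullet x)\bullet(z\bullet x)$ for all $x,y,z$, and distributive if it is both. Define $a\approx b$ iff $L_a=L_b$ and $\mathbf{R}_a=\mathbf{R}_b$; this is a congruence of the birack (an equivalence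 relation compatible with all four operations), and $\mathrm{Ret}(X)$ denotes the quotient birack $X/\mathord{\approx}$. Put $\mathrm{Ret}^0(X)=X$ and $\mathrm{Ret}^{j}(X)=\mathrm{Ret}(\mathrm{Ret}^{j-1}(X))$ for $j\geq1$. For $m\ge 1$, the birack is: - left $m$-reductive if $(\ldots((x_0\circ x_1)\circ x_2)\ldots)\circ x_m=(\ldots((x_1\circ x_2)\circ x_3)\ldots)\circ x_m$ for all $x_0,\dots,x_m\in X$ (for $m=1$: $x_0\circ x_1=x_1$); - right $m$-reductive if $x_0\bullet(\ldots(x_{m-2}\bullet(x_{m-1}\bullet x_m))\ldots)=x_0\bullet(\ldots(x_{m-3}\bullet(x_{m-2}\bullet x_{m-1}))\ldots)$ for all $x_0,\dots,x_m\in X$ (for $m=1$: $x_0\bullet x_1=x_0$); - left $m$-permutational if $(\ldots((x\circ x_1)\circ x_2)\ldots)\circ x_m=(\ldots((y\circ x_1)\circ x_2)\ldots)\circ x_m$ for all $x,y,x_1,\dots,x_m\in X$; - right $m$-permutational if $x_0\bullet(\ldots(x_{m-2}\bullet(x_{m-1}\bullet x))\ldots)=x_0\bullet(\ldots(x_{m-2}\bullet(x_{m-1}\bullet y))\ldots)$ for all $x,y,x_0,\dots,x_{m-1}\in X$; - $m$-reductive (resp. $m$-permutational) if it is both left and right $m$-reductive (resp. $m$-permutational). Nilpotency class: $\gamma_0(G)=G$, $\gamma_i(G)=[\gamma_{i-1}(G),G]$ for $i\ge1$; $G$ is nilpotent of class $j$ if $j$ is the smallest number with $\gamma_j(G)=\{1\}$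 (so class $0$ means trivial). *)

(* Defs.v *)
From HB Require Import structures.
From mathcomp Require Import all_boot.
From mathcomp Require Import boolp classical_sets functions cardinality.

Set Implicit Arguments.
Unset Strict Implicit.
Unset Printing Implicit Defensive.

Declare Scope birack_scope.
Delimit Scope birack_scope with birack.
Local Open Scope classical_set_scope.
Local Open Scope quotient_scope.
Local Open Scope birack_scope.

Reserved Notation "x ∘ y" (at level 40, left associativity).
Reserved Notation "x \∘ y" (at level 40, left associativity).
Reserved Notation "x • y" (at level 40, left associativity).
Reserved Notation "x /• y" (at level 40, left associativity).

Record biralg := Biralg {
  biralg_sort :> Type;
  circ : biralg_sort -> biralg_sort -> biralg_sort;
  ldiv : biralg_sort -> biralg_sort -> biralg_sort;
  bul : biralg_sort -> biralg_sort -> biralg_sort;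
  rdiv : biralg_sort -> biralg_sort -> biralg_sort }.

Notation "x ∘ y" := (circ x y) : birack_scope.
Notation "x \∘ y" := (ldiv x y) : birack_scope.
Notation "x • y" := (bul x y) : birack_scope.
Notation "x /• y" := (rdiv x y) : birack_scope.

Record birack (X : biralg) : Prop := Birack {
  circ_ldiv : forall x y : X, x ∘ (x \∘ y) = y;
  ldiv_circ : forall x y : X, x \∘ (x ∘ y) = y;
  rdiv_bul : forall x y : X, (y /• x) • x = y;
  bul_rdiv : forall x y : X, (y • x) /• x = y;
  birack_circ : forall x y z : X,
    x ∘ (y ∘ z) = (x ∘ y) ∘ ((x • y) ∘ z);
  birack_mid : forall x y z : X,
    (x ∘ y) • ((x • y) ∘ z) = (x • (y ∘ z)) ∘ (y • z);
  birack_bul : forall x y z : X,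
    (x • y) • z = (x • (y ∘ z)) • (y • z) }.

Definition left_distr (X : biralg) : Prop :=
  forall x y z : X, x ∘ (y ∘ z) = (x ∘ y) ∘ (x ∘ z).

Definition right_distr (X : biralg) : Prop :=
  forall x y z : X, (y • z) • x = (y • x) • (z • x).

Definition distributive_birack (X : biralg) : Prop :=
  [/\ birack X, left_distr X & right_distr X].

Definition Lmap (X : biralg) (x : X) : X -> X := fun a => x ∘ a.
Definition Rmap (X : biralg) (x : X) : X -> X := fun a => a • x.

Section Retract.
Variable X : biralg.

Definition ret_rel : rel {classic X} :=
  fun a b => `[< Lmap a = Lmap b /\ Rmap a = Rmap b >].

Lemma ret_relP (a b : X) :
  reflect (Lmap a = Lmap b /\ Rmap a = Rmap b) (ret_rel a b).
Proof. exact: asboolP. Qed.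

Lemma ret_rel_refl : reflexive ret_rel.
Proof. by move=> a; apply/ret_relP. Qed.

Lemma ret_rel_sym : symmetric ret_rel.
Proof. by move=> a b; apply/ret_relP/ret_relP => -[La Ra]; split. Qed.

Lemma ret_rel_trans : transitive ret_rel.
Proof. move=> b a c /ret_relP[Lab Rab] /ret_relP[Lbc Rbc]; apply/ret_relP.
by rewrite Lab Rab. Qed.

Canonical ret_equiv := EquivRel ret_rel ret_rel_refl ret_rel_sym ret_rel_trans.

(* The operations are computed on representatives. This makes sense for any
   algebra, and [pi_circ], [pi_ldiv], [pi_bul], [pi_rdiv] below show that for
   distributive biracks the choice of representatives does not matter. *)
Definition Ret : biralg :=
  let Q := {eq_quot ret_equiv} in
  @Biralg Q
    (fun u v => \pi_Q ((repr u : X) ∘ (repr v : X)))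
    (fun u v => \pi_Q ((repr u : X) \∘ (repr v : X)))
    (fun u v => \pi_Q ((repr u : X) • (repr v : X)))
    (fun u v => \pi_Q ((repr u : X) /• (repr v : X))).

Definition ret_pi (a : X) : Ret := \pi_{eq_quot ret_equiv} a.

Lemma ret_piP (a b : X) :
  ret_pi a = ret_pi b <-> Lmap a = Lmap b /\ Rmap a = Rmap b.
Proof.
split=> [/eqmodP/ret_relP //|ab].
by apply/eqmodP/ret_relP.
Qed.

Lemma ret_reprP (u : Ret) : exists2 a : X, ret_pi a = u &
  a = repr (u : {eq_quot ret_equiv}) :> X.
Proof. by exists (repr (u : {eq_quot ret_equiv})) => //; exact: reprK. Qed.

Section Congruence.
Hypothesis dX : distributive_birack X.

Lemma distr_bul_circ (x y z : X) : (x • y) ∘ z = x ∘ z.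
Proof.
case: dX => bX ld _.
by rewrite -(ldiv_circ bX (x ∘ y) ((x • y) ∘ z)) -(birack_circ bX) ld
  (ldiv_circ bX).
Qed.

Lemma distr_bul_circr (x y z : X) : x • (y ∘ z) = x • z.
Proof.
case: dX => bX _ rd.
by rewrite -(bul_rdiv bX (y • z) (x • (y ∘ z))) -(birack_bul bX) rd
  (bul_rdiv bX).
Qed.

Lemma ret_rel_pointwise (a b : X) : ret_rel a b <->
  (forall z : X, a ∘ z = b ∘ z) /\ (forall z : X, z • a = z • b).
Proof.
split=> [/ret_relP[Lab Rab]|[Lab Rab]].
  by split=> z; [rewrite -/(Lmap a z) Lab|rewrite -/(Rmap a z) Rab].
by apply/ret_relP; split; apply/funext.
Qed.

Lemma ret_circ (a a' b b' : X) : ret_rel a a' -> ret_rel b b' ->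
  ret_rel (a ∘ b) (a' ∘ b').
Proof.
case: dX => bX ld _ /ret_rel_pointwise[La Ra] /ret_rel_pointwise[Lb Rb].
apply/ret_rel_pointwise; split=> z.
  by rewrite -{1}(circ_ldiv bX a z) -ld Lb !La ld -(La (a \∘ z)) circ_ldiv.
by rewrite !distr_bul_circr.
Qed.

Lemma ret_bul (a a' b b' : X) : ret_rel a a' -> ret_rel b b' ->
  ret_rel (a • b) (a' • b').
Proof.
case: dX => bX _ rd /ret_rel_pointwise[La Ra] /ret_rel_pointwise[Lb Rb].
apply/ret_rel_pointwise; split=> z.
  by rewrite !distr_bul_circ.
by rewrite -{1}(rdiv_bul bX b z) -rd Ra !Rb rd -(Rb (z /• b)) rdiv_bul.
Qed.

Lemma ret_ldiv (a a' b b' : X) : ret_rel a a' -> ret_rel b b' ->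
  ret_rel (a \∘ b) (a' \∘ b').
Proof.
case: dX => bX ld _ /ret_rel_pointwise[La Ra] /ret_rel_pointwise[Lb Rb].
have E (u v z : X) : (u \∘ v) ∘ z = u \∘ (v ∘ (u ∘ z)).
  by rewrite -{2}(circ_ldiv bX u v) -ld (ldiv_circ bX).
have Ea z : a \∘ z = a' \∘ z.
  by rewrite -{1}(circ_ldiv bX a' z) -La (ldiv_circ bX).
apply/ret_rel_pointwise; split=> z.
  by rewrite !E Ea Lb La.
rewrite -(distr_bul_circr z a (a \∘ b)) -(distr_bul_circr z a' (a' \∘ b')).
by rewrite !(circ_ldiv bX).
Qed.

Lemma ret_rdiv (a a' b b' : X) : ret_rel a a' -> ret_rel b b' ->
  ret_rel (a /• b) (a' /• b').
Proof.
case: dX => bX _ rd /ret_rel_pointwise[La Ra] /ret_rel_pointwise[Lb Rb].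
have E (u v z : X) : z • (v /• u) = ((z • u) • v) /• u.
  by rewrite -{2}(rdiv_bul bX u v) -rd (bul_rdiv bX).
have Eb z : z /• b = z /• b'.
  by rewrite -{1}(rdiv_bul bX b' z) -Rb (bul_rdiv bX).
apply/ret_rel_pointwise; split=> z.
  rewrite -(distr_bul_circ (a /• b) b) -(distr_bul_circ (a' /• b') b').
  by rewrite !(rdiv_bul bX).
by rewrite !E Eb Ra Rb.
Qed.

Lemma ret_repr_pi (a : X) :
  ret_rel (repr (ret_pi a : {eq_quot ret_equiv})) a.
Proof. by apply/(@eqmodP _ ret_equiv); rewrite reprK. Qed.

Lemma pi_circ (a b : X) : ret_pi a ∘ ret_pi b = ret_pi (a ∘ b).
Proof. by apply/eqmodP/ret_circ; exact: ret_repr_pi. Qed.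

Lemma pi_ldiv (a b : X) : ret_pi a \∘ ret_pi b = ret_pi (a \∘ b).
Proof. by apply/eqmodP/ret_ldiv; exact: ret_repr_pi. Qed.

Lemma pi_bul (a b : X) : ret_pi a • ret_pi b = ret_pi (a • b).
Proof. by apply/eqmodP/ret_bul; exact: ret_repr_pi. Qed.

Lemma pi_rdiv (a b : X) : ret_pi a /• ret_pi b = ret_pi (a /• b).
Proof. by apply/eqmodP/ret_rdiv; exact: ret_repr_pi. Qed.

Definition pi_ops := (pi_circ, pi_ldiv, pi_bul, pi_rdiv).

Lemma Ret_distributive : distributive_birack Ret.
Proof.
have S (u : Ret) : exists a, ret_pi a = u by have [a <- _] := ret_reprP u; exists a.
case: (dX) => bX ld rd; split; first split.
- by move=> x y; have [a <-] := S x; have [b <-] := S y;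
    rewrite !pi_ops (circ_ldiv bX).
- by move=> x y; have [a <-] := S x; have [b <-] := S y;
    rewrite !pi_ops (ldiv_circ bX).
- by move=> x y; have [a <-] := S x; have [b <-] := S y;
    rewrite !pi_ops (rdiv_bul bX).
- by move=> x y; have [a <-] := S x; have [b <-] := S y;
    rewrite !pi_ops (bul_rdiv bX).
- by move=> x y z; have [a <-] := S x; have [b <-] := S y; have [c <-] := S z;
    rewrite !pi_ops (birack_circ bX).
- by move=> x y z; have [a <-] := S x; have [b <-] := S y; have [c <-] := S z;
    rewrite !pi_ops (birack_mid bX).
- by move=> x y z; have [a <-] := S x; have [b <-] := S y; have [c <-] := S z;
    rewrite !pi_ops (birack_bul bX).
- by move=> x y z; have [a <-] := S x; have [b <-] := S y; have [c <-] := S z;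
    rewrite !pi_ops ld.
- by move=> x y z; have [a <-] := S x; have [b <-] := S y; have [c <-] := S z;
    rewrite !pi_ops rd.
Qed.

End Congruence.
End Retract.

Definition iter_ret (k : nat) (X : biralg) : biralg := iter k Ret X.

(* In the four identities below the sequence [s] holds the variables that are
   not displayed: x_2, ..., x_m and x_0, ..., x_(m-2) in the reductive laws,
   x_1, ..., x_m and x_0, ..., x_(m-1) in the permutational ones. *)
Definition left_reductive (m : nat) (X : biralg) : Prop :=
  forall (x0 x1 : X) (s : seq X), (size s).+1 = m ->
    foldl (@circ X) (x0 ∘ x1) s = foldl (@circ X) x1 s.

Definition right_reductive (m : nat) (X : biralg) : Prop :=
  forall (s : seq X) (y z : X), (size s).+1 = m ->
    foldr (@bul X) (y • z) s = foldr (@bul X) y s.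

Definition left_permutational (m : nat) (X : biralg) : Prop :=
  forall (x y : X) (s : seq X), size s = m ->
    foldl (@circ X) x s = foldl (@circ X) y s.

Definition right_permutational (m : nat) (X : biralg) : Prop :=
  forall (s : seq X) (x y : X), size s = m ->
    foldr (@bul X) x s = foldr (@bul X) y s.

Definition reductive (m : nat) (X : biralg) : Prop :=
  left_reductive m X /\ right_reductive m X.

Definition permutational (m : nat) (X : biralg) : Prop :=
  left_permutational m X /\ right_permutational m X.

(* The symmetric group of an arbitrary, possibly infinite, type. *)
Record symg (T : Type) := Symg {
  symg_fun :> T -> T;
  symg_inv : T -> T;
  symg_funK : cancel symg_fun symg_inv;
  symg_invK : cancel symg_inv symg_fun }.

Section SymmetricGroup.
Variable T : Type.
Implicit Types p q r : symg T.

Lemma symgP p q : symg_fun p = symg_fun q -> p = q.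
Proof.
case: p q => [f g fK gK] [f' g' fK' gK'] /= ff'; subst f'.
have gg' : g = g' by apply/funext => t; rewrite -{1}(gK' t) fK.
by subst g'; rewrite (Prop_irrelevance fK fK') (Prop_irrelevance gK gK').
Qed.

HB.instance Definition _ := gen_eqMixin (symg T).
HB.instance Definition _ := gen_choiceMixin (symg T).

Definition symg_one : symg T := @Symg T id id (fun=> erefl) (fun=> erefl).

Definition symg_mul p q : symg T :=
  Symg (can_comp (symg_funK p) (symg_funK q))
       (can_comp (symg_invK q) (symg_invK p)).

Definition symg_opp p : symg T := Symg (symg_invK p) (symg_funK p).

Lemma symg_mulA : associative symg_mul.
Proof. by move=> p q r; exact: symgP. Qed.

Lemma symg_mul1g : left_id symg_one symg_mul.
Proof. by move=> p; exact: symgP. Qed.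

Lemma symg_mulg1 : right_id symg_one symg_mul.
Proof. by move=> p; exact: symgP. Qed.

Lemma symg_mulVg : left_inverse symg_one symg_opp symg_mul.
Proof. by move=> p; apply/symgP/funext => t /=; rewrite symg_funK. Qed.

Lemma symg_mulgV : right_inverse symg_one symg_opp symg_mul.
Proof. by move=> p; apply/symgP/funext => t /=; rewrite symg_invK. Qed.

HB.instance Definition _ := isGroup.Build (symg T)
  symg_mulA symg_mul1g symg_mulg1 symg_mulVg symg_mulgV.

End SymmetricGroup.

Definition generated (G : groupType) (A : set G) : set G :=
  smallest (fun H : set G => group_closed [in H]) A.

Definition lower_central (G : groupType) (H : set G) (n : nat) : set G :=
  iter n (fun K : set G =>
    generated [set commg x y | x in K & y in H]) H.

Definition nilpotent_of_class (G : groupType) (H : set G) (j : nat) : Prop :=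
  lower_central H j = [set 1%g] /\
  forall i, i < j -> lower_central H i <> [set 1%g].

Definition Mlt (X : biralg) : set (symg X) :=
  generated [set p : symg X |
    exists x : X, symg_fun p = Lmap x \/ symg_fun p = Rmap x].

Arguments Mlt : clear implicits.

Lemma Lmap_symg (X : biralg) (x : X) : birack X ->
  exists p : symg X, symg_fun p = Lmap x.
Proof. by move=> bX; exists (Symg (ldiv_circ bX x) (circ_ldiv bX x)). Qed.

Lemma Rmap_symg (X : biralg) (x : X) : birack X ->
  exists p : symg X, symg_fun p = Rmap x.
Proof.
move=> bX.
by exists (@Symg X (Rmap x) (fun y => y /• x) (bul_rdiv bX x) (rdiv_bul bX x)).
Qed.

(* Main.v *)
(* Let [~_j] be the kernel of the projection X -> Ret^j(X).  Distributivity
   gives (x • y) ∘ z = x ∘ z and x • (y ∘ z) = x • z, so a word mixing both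
   operations does not depend on its innermost letter.  Hence [a ~_j b] iff a
   and b agree as innermost letters of all pure left and pure right words of
   length j.  This makes (i), (ii), (iii) equivalent, and says that X is
   k-reductive iff L_x a ~_(k-1) a and R_x a ~_(k-1) a for all x, a.

   Every element of Mlt(X) is an automorphism of X.  Therefore g x ~_(j+1) x
   for all x iff, modulo the elements acting trivially on Ret^j(X), g commutes
   with all L_z and R_z: the subgroups
     Z_j = {g in Mlt(X) | g x ~_j x for all x}
   form the upper central series of Mlt(X).  So Mlt(X) has class at most k-1
   iff Z_(k-1) = Mlt(X), and by transitivity of [~_(k-1)] this may be tested on
   the generators L_x, R_x. *)
Require Import Defs.
From mathcomp Require Import all_boot.
From mathcomp Require Import boolp classical_sets functions cardinality.
Local Open Scope classical_set_scope.
Local Open Scope card_scope.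
Local Open Scope birack_scope.

Set Implicit Arguments.
Unset Strict Implicit.
Unset Printing Implicit Defensive.

(** * Generated subgroups and their lower central series *)

Section Generated.
Variable G : groupType.
Implicit Types A H : set G.

Lemma generated_closed A : group_closed [in generated A].
Proof.
split=> [|x y]; rewrite !inE.
  by move=> H [[H1 _] _]; rewrite inE in H1.
move=> Ax Ay H /[dup] HA [[_ HB] _]; have := HB x y.
by rewrite !inE; apply; [exact: Ax|exact: Ay].
Qed.

Lemma generated1 A : generated A 1%g.
Proof. by have [A1 _] := generated_closed A; rewrite inE in A1. Qed.

Lemma generated_sub A H : H 1%g -> (forall x y, H x -> H y -> H (x / y)%g) ->
  A `<=` H -> generated A `<=` H.
Proof.
move=> H1 HB; apply: smallest_sub; split=> [|x y]; rewrite !inE //.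
exact: HB.
Qed.

Lemma sub_generated A : A `<=` generated A.
Proof. exact: sub_gen_smallest. Qed.

Lemma generatedM A x y : generated A x -> generated A y ->
  generated A (x * y)%g.
Proof.
have := @group_closedM _ _ (generated_closed A) x y.
by rewrite !inE.
Qed.

Lemma generatedV A x : generated A x -> generated A x^-1%g.
Proof.
by have := @group_closedV _ _ (generated_closed A) x; rewrite !inE.
Qed.

Lemma lower_central_sub A n : lower_central (generated A) n `<=` generated A.
Proof.
elim: n => [//|n IH]; apply: generated_sub; first exact: generated1.
  by move=> x y Ax Ay; apply: generatedM => //; exact: generatedV.
move=> _ [x /IH Ax [y Ay <-]]; rewrite /commg /conjg.
by do ![apply: generatedM|apply: generatedV].
Qed.

Lemma lower_central1 A n : lower_central (generated A) n 1%g.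
Proof. by case: n => [|n]; exact: generated1. Qed.

Lemma lower_central_comm A n x y : lower_central (generated A) n x ->
  generated A y -> lower_central (generated A) n.+1 (commg x y).
Proof. by move=> nx Ay; apply: sub_generated; exists x => //; exists y. Qed.

Lemma lower_central_trivS A n :
  lower_central (generated A) n = [set 1%g] ->
  lower_central (generated A) n.+1 = [set 1%g].
Proof.
move=> n1; rewrite eqEsubset; split=> [|_ ->]; last exact: generated1.
apply: generated_sub => [//|x y -> ->|]; first by rewrite mulgV.
move=> _ [x xn [y _ <-]]; move: xn.
by rewrite -[X in X x]/(lower_central (generated A) n) n1 => ->; rewrite comm1g.
Qed.

(** Once a term of the series is trivial all later ones are, so a bound on the class is a condition
    on a single term; the class itself is the least index with trivial term. *)
Lemma nilpotent_class_leP A c :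
  (exists2 j, j <= c & nilpotent_of_class (generated A) j) <->
  lower_central (generated A) c = [set 1%g].
Proof.
split=> [[j /subnKC <- [j1 _]]|c1].
  elim: (c - j) => [|n IH]; first by rewrite addn0.
  by rewrite addnS; exact: lower_central_trivS.
pose P n := `[< lower_central (generated A) n = [set 1%g] >].
have exP : exists n, P n by exists c; exact/asboolP.
case: (ex_minnP exP) => j /asboolP j1 jmin.
exists j; first by apply: jmin; exact/asboolP.
by split=> // i ij /asboolP/jmin; rewrite leqNgt ij.
Qed.

End Generated.

(** * Kernels of the iterated retracts, and words *)

(** This is [~_j], defined by recursion inside X so that nested quotients are avoided;
    [iter_ret_eq_Ret] links it to [Ret]. *)
Fixpoint iter_ret_eq (X : biralg) (j : nat) (a b : X) : Prop :=
  if j is j'.+1 then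
    forall z, iter_ret_eq j' (a ∘ z) (b ∘ z) /\ iter_ret_eq j' (z • a) (z • b)
  else a = b.

Section IterRetEq.
Variable X : biralg.
Implicit Types a b c x y z : X.

Lemma iter_ret_eqS j a b : iter_ret_eq j.+1 a b <->
  forall z, iter_ret_eq j (a ∘ z) (b ∘ z) /\ iter_ret_eq j (z • a) (z • b).
Proof. by []. Qed.

Lemma iter_ret_eq_refl j a : iter_ret_eq j a a.
Proof. by elim: j a => [|j IH] a //= z; split. Qed.

Lemma iter_ret_eq_sym j a b : iter_ret_eq j a b -> iter_ret_eq j b a.
Proof.
by elim: j a b => [|j IH] a b //= ab z; case: (ab z); split; exact: IH.
Qed.

Lemma iter_ret_eq_trans j b a c :
  iter_ret_eq j a b -> iter_ret_eq j b c -> iter_ret_eq j a c.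
Proof.
elim: j a b c => [|j IH] a b c /=; first by move=> ->.
move=> ab bc z; have [? ?] := ab z; have [? ?] := bc z.
by split; [exact: (IH _ (b ∘ z))|exact: (IH _ (z • b))].
Qed.

Lemma iter_ret_eq_foldl j a b (s : seq X) : iter_ret_eq j a b -> size s = j ->
  foldl (@circ X) a s = foldl (@circ X) b s.
Proof.
elim: j a b s => [|j IH] a b [|z s] //= ab [ss].
by apply: IH ss; case: (ab z).
Qed.

Lemma iter_ret_eq_foldr j a b (s : seq X) : iter_ret_eq j a b -> size s = j ->
  foldr (@bul X) a s = foldr (@bul X) b s.
Proof.
elim: j a b s => [|j IH] a b; first by move=> [|//] /= ->.
case/lastP=> [//|s z] ab; rewrite size_rcons => -[ss]; rewrite !foldr_rcons.
by apply: IH ss; case: (ab z).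
Qed.

Hypothesis dX : distributive_birack X.

(** L_x and R_z commute: [birack_mid] reduces to this once its absorbed inner letters are
    dropped. *)
Lemma circ_bul x y z : x ∘ (y • z) = (x ∘ y) • z.
Proof.
have [bX _ _] := dX.
rewrite -(distr_bul_circr dX (x ∘ y) (x • y) z) (birack_mid bX).
by rewrite (distr_bul_circ dX).
Qed.

Lemma iter_ret_eq_words j a b :
  (forall s, size s = j -> foldl (@circ X) a s = foldl (@circ X) b s) ->
  (forall s, size s = j -> foldr (@bul X) a s = foldr (@bul X) b s) ->
  iter_ret_eq j a b.
Proof.
elim: j a b => [|j IH] a b ll rr /=; first exact: (ll [::]).
move=> z; split; apply: IH => s sj.
- by apply: (ll (z :: s)); rewrite /= sj.
(* The letter w next to a ∘ z gives w • (a ∘ z) = w • z, free of a. If there is no w, then a ∘ z is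
   itself a pure left word. *)
- case/lastP: s sj => [|s w] sj; first by apply: (ll [:: z]); rewrite -sj.
  by rewrite !foldr_rcons !(distr_bul_circr dX).
- case: s sj => [|w s] sj; first by apply: (rr [:: z]); rewrite -sj.
  by rewrite /= !(distr_bul_circ dX).
- by rewrite -!foldr_rcons; apply: rr; rewrite size_rcons sj.
Qed.

Lemma permutationalP k : permutational k X <-> forall a b, iter_ret_eq k a b.
Proof.
split=> [[lp rp] a b|e].
  by apply: iter_ret_eq_words => s; [exact: lp|exact: rp].
split=> [x y s|s x y]; first exact: iter_ret_eq_foldl.
exact: iter_ret_eq_foldr.
Qed.

Lemma reductiveP k : 0 < k -> reductive k.+1 X <->
  forall x y, iter_ret_eq k (x ∘ y) y /\ iter_ret_eq k (y • x) y.
Proof.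
move=> k0; split=> [[lr rr] x y|e].
  split; apply: iter_ret_eq_words => s sk.
  - by apply: lr; rewrite sk.
  (* As k > 0 there is a letter w, and w • (x ∘ y) = w • y. The other mixed case is symmetric. *)
  - case/lastP: s sk => [sk|s w _]; first by rewrite -sk in k0.
    by rewrite !foldr_rcons (distr_bul_circr dX).
  - case: s sk => [sk|w s _ /=]; first by rewrite -sk in k0.
    by rewrite (distr_bul_circ dX).
  - by apply: rr; rewrite sk.
split=> [x0 x1 s|s y z] [sk].
  by apply: iter_ret_eq_foldl sk; have [] := e x0 x1.
by apply: iter_ret_eq_foldr sk; have [] := e z y.
Qed.

(* Since L_(x ∘ x) = L_x and R_(x • x) = R_x, in k-permutationality the letter
   x1 can be replaced by x1 ∘ x1, respectively by x1 • x1. *)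
Lemma permutational_reductive k : 1 < k -> permutational k X -> reductive k X.
Proof.
have [bX ld rd] := dX.
case: k => [|[|k]] // _ [lp rp]; split=> [x0 x1 [|z s] //= [sk]|].
  have -> : x1 ∘ z = (x1 ∘ x1) ∘ z.
    by rewrite -{2}(circ_ldiv bX x1 z) -ld circ_ldiv.
  by apply: (lp x0 x1 [:: x1, z & s]); rewrite /= sk.
case/lastP=> [//|s w] y z; rewrite size_rcons => -[sk].
rewrite !foldr_rcons.
have -> : w • y = w • (y • y) by rewrite -{2}(rdiv_bul bX y w) -rd rdiv_bul.
have := rp (rcons (rcons s w) y) z y.
by rewrite !foldr_rcons; apply; rewrite !size_rcons sk.
Qed.

(** The reductive law deletes the innermost letter, which leaves the same word on both sides. *)
Lemma reductive_permutational k : 0 < k -> reductive k X -> permutational k X.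
Proof.
case: k => // k _ [lr rr]; split=> [x y [//|z s] /= sk|].
  by rewrite !lr.
case/lastP=> [//|s z] x y; rewrite size_rcons => sk.
by rewrite !foldr_rcons !rr.
Qed.

End IterRetEq.

(** * Passage to the retract *)

(** Induction on j: the base case is the definition of the retract, and the step holds because the
    projection is a surjective homomorphism. *)
Lemma iter_ret_eq_Ret (X : biralg) j (a b : X) : distributive_birack X ->
  iter_ret_eq j (ret_pi a) (ret_pi b) <-> iter_ret_eq j.+1 a b.
Proof.
move=> dX; elim: j a b => [|j IH] a b.
  rewrite [iter_ret_eq 0 _ _]/= ret_piP.
  split=> [[La Ra] z|e].
    by split; [exact: (congr1 (@^~ z) La)|exact: (congr1 (@^~ z) Ra)].
  by split; apply/funext => z; case: (e z).
rewrite iter_ret_eqS [X in _ <-> X]iter_ret_eqS; split=> e z.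
  by have := e (ret_pi z); rewrite !(pi_ops dX) !IH.
have [c <- _] := ret_reprP z.
by rewrite !(pi_ops dX) !IH; exact: e.
Qed.

Lemma permutational_Ret (X : biralg) k : distributive_birack X ->
  permutational k (Ret X) <-> permutational k.+1 X.
Proof.
move=> dX; rewrite (permutationalP dX) (permutationalP (Ret_distributive dX)).
split=> e a b; first by rewrite -(iter_ret_eq_Ret k a b dX).
have [a' <- _] := ret_reprP a; have [b' <- _] := ret_reprP b.
by rewrite iter_ret_eq_Ret.
Qed.

Lemma card_iter_ret (X : biralg) k : distributive_birack X ->
  [set: X] !=set0 -> [set: iter_ret k X] #= `I_1 <-> permutational k X.
Proof.
elim: k X => [|k IH] X dX X0.
  rewrite (permutationalP dX) /=; case: X0 => a _; split=> [|e].
    case/card_set_bijP => f [f0 finj _] x y.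
    apply: finj; rewrite ?inE //.
    by have := (f0 x I, f0 y I); case: (f x) (f y) => [|?] [|?] // [].
  by have -> : [set: X] = [set a] by [apply/seteqP; split=> // x _; exact: e];
     exact: card_set1.
(* The innermost retract is split off, so that the induction hypothesis applies to [Ret X]. *)
rewrite /iter_ret iterSr -/(iter_ret k _) -permutational_Ret // IH //.
  exact: Ret_distributive.
by case: X0 => a _; exists (ret_pi a).
Qed.

(** * The multiplication group and its central series *)

Section Multiplication.
Variable X : biralg.
Hypothesis dX : distributive_birack X.
Let bX : birack X. Proof. by case: dX. Qed.
Implicit Types (g h p : symg X) (a b x y z : X).

Definition birack_aut : set (symg X) := [set g |
  (forall x y, g (x ∘ y) = g x ∘ g y) /\ (forall x y, g (x • y) = g x • g y)].

Let symgE g h x : (g * h)%g x = g (h x). Proof. by []. Qed.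
Let symgV g x : (g^-1)%g (g x) = x. Proof. exact: symg_funK. Qed.
Let symgVV g x : g ((g^-1)%g x) = x. Proof. exact: symg_invK. Qed.

Lemma birack_autV g : birack_aut g -> birack_aut g^-1%g.
Proof.
move=> [gc gb]; split=> x y.
  by rewrite -{1}(symgVV g x) -{1}(symgVV g y) -gc symgV.
by rewrite -{1}(symgVV g x) -{1}(symgVV g y) -gb symgV.
Qed.

Lemma birack_autB g h : birack_aut g -> birack_aut h -> birack_aut (g / h)%g.
Proof.
move=> [gc gb] /birack_autV[hc hb].
by split=> x y; rewrite !symgE ?hc ?hb ?gc ?gb.
Qed.

(** For •, commutation with R_z and absorption give x ∘ (y • z) = (x ∘ y) • z = (x ∘ y) • (x ∘
    z). *)
Lemma Lmap_aut g x : symg_fun g = Lmap x -> birack_aut g.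
Proof.
have [_ ld _] := dX.
move=> gx; split=> y z; rewrite gx /Lmap; first exact: ld.
by rewrite (circ_bul dX) (distr_bul_circr dX).
Qed.

Lemma Rmap_aut g x : symg_fun g = Rmap x -> birack_aut g.
Proof.
have [_ _ rd] := dX.
move=> gx; split=> y z; rewrite gx /Rmap; last exact: rd.
by rewrite -(circ_bul dX) (distr_bul_circ dX).
Qed.

Lemma Mlt_aut : Mlt X `<=` birack_aut.
Proof.
apply: generated_sub; [by split|exact: birack_autB|].
by move=> g [x [/Lmap_aut|/Rmap_aut]].
Qed.

Lemma Mlt_Lmap x : exists2 g, Mlt X g & symg_fun g = Lmap x.
Proof.
have [g gx] := Lmap_symg x bX; exists g => //.
by apply: sub_generated; exists x; left.
Qed.

Lemma Mlt_Rmap x : exists2 g, Mlt X g & symg_fun g = Rmap x.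
Proof.
have [g gx] := Rmap_symg x bX; exists g => //.
by apply: sub_generated; exists x; right.
Qed.

Lemma iter_ret_eq_aut j g a b : birack_aut g ->
  iter_ret_eq j a b -> iter_ret_eq j (g a) (g b).
Proof.
move=> [gc gb]; elim: j a b => [|j IH] a b /=; first by move=> ->.
move=> ab z; rewrite -(symgVV g z) -!gc -!gb.
by split; apply: IH; case: (ab ((g^-1)%g z)).
Qed.

(** The subgroup Z_j is the part of this set inside [Mlt X]. *)
Definition acts_trivially j : set (symg X) :=
  [set g | forall x, iter_ret_eq j (g x) x].

Lemma acts_trivially1 j : acts_trivially j 1%g.
Proof. by move=> x; exact: iter_ret_eq_refl. Qed.

Lemma acts_triviallyB j g h : acts_trivially j g -> acts_trivially j h ->
  acts_trivially j (g / h)%g.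
Proof.
move=> gj hj x; apply: iter_ret_eq_trans (gj _) _.
by apply: iter_ret_eq_sym; have := hj ((h^-1)%g x); rewrite symgVV.
Qed.

(** For the generator h = L_z, g (z ∘ x) = g z ∘ g x ~_j z ∘ g x because g z ~_(j+1) z; likewise for
    R_z. *)
Lemma acts_trivially_commute j g h : Mlt X h -> acts_trivially j.+1 g ->
  Mlt X g -> forall x, iter_ret_eq j (g (h x)) (h (g x)).
Proof.
move=> Gh gj /Mlt_aut[gc gb].
(* Being an automorphism is carried along because closure under quotients transports [~_j] by h1 and
   by the inverse of h2. *)
suff /(_ h Gh)[] : Mlt X `<=` [set h | birack_aut h /\
    forall x, iter_ret_eq j (g (h x)) (h (g x))] by [].
apply: generated_sub => [|h1 h2 [a1 c1] [a2 c2]|p [z pz]].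
- by split=> // x; exact: iter_ret_eq_refl.
- split=> [|x]; first exact: birack_autB.
  rewrite !symgE; apply: iter_ret_eq_trans (c1 _) _.
  apply: iter_ret_eq_aut => //; rewrite -{2}(symgVV h2 x).
  set y := (h2^-1)%g x; rewrite -[X in iter_ret_eq _ X _](symgV h2).
  apply: iter_ret_eq_aut; first exact: birack_autV.
  exact/iter_ret_eq_sym/c2.
- case: pz => pz.
    split=> [|x]; first exact: Lmap_aut pz.
    by rewrite pz /Lmap gc; have [] := gj z (g x).
  split=> [|x]; first exact: Rmap_aut pz.
  by rewrite pz /Rmap gb; have [] := gj z (g x).
Qed.

(** Follows from g h = h g [g, h], as g, h and their inverses preserve [~_j]. *)
Lemma acts_trivially_comm j g h : Mlt X g -> Mlt X h ->
  acts_trivially j (commg g h) <->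
  forall x, iter_ret_eq j (g (h x)) (h (g x)).
Proof.
move=> /Mlt_aut ga /Mlt_aut ha.
have E x : h (g (commg g h x)) = g (h x).
  by rewrite /commg /conjg !symgE !symgVV.
split=> c x.
  by rewrite -E; do 2![apply: iter_ret_eq_aut => //].
have := iter_ret_eq_aut (birack_autV ha) (c x).
move/(iter_ret_eq_aut (birack_autV ga)).
by rewrite -E !symgV.
Qed.

Lemma acts_triviallyS j g : Mlt X g -> acts_trivially j.+1 g <->
  (forall h, Mlt X h -> acts_trivially j (commg g h)).
Proof.
move=> Gg; split=> [gj h Gh|c x z].
  by apply/acts_trivially_comm => //; exact: acts_trivially_commute.
(* With z = g y, the two relations to prove say that g commutes with L_x and R_x at y modulo
   [~_j]. *)
have [gc gb] := Mlt_aut Gg; rewrite -(symgVV g z); set y := (g^-1)%g z.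
rewrite -gc -gb; split.
  have [h Gh hx] := Mlt_Lmap x.
  by have /(acts_trivially_comm _ Gg Gh)/(_ y) := c h Gh; rewrite hx.
have [h Gh hx] := Mlt_Rmap x.
by have /(acts_trivially_comm _ Gg Gh)/(_ y) := c h Gh; rewrite hx.
Qed.

Lemma lower_central_acts_trivially c :
  lower_central (Mlt X) c = [set 1%g] <-> Mlt X `<=` acts_trivially c.
Proof.
split=> [c1|Gc].
  (* Descending from the trivial term: commutators of the n-th term lie in the next one, hence in
     Z_j, which puts the n-th term in Z_(j+1). *)
  suff desc j n : lower_central (Mlt X) (n + j) = [set 1%g] ->
    lower_central (Mlt X) n `<=` acts_trivially j by exact: (desc c 0).
  elim: j n => [|j IH] n; first by rewrite addn0 => -> _ ->.
  rewrite addnS -addSn => /IH n1 g ng; apply/acts_triviallyS.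
    exact: lower_central_sub ng.
  by move=> h Gh; apply: n1; exact: lower_central_comm.
(* Each commutator lowers the index of Z by one; at i = c the term lies in Z_0, where [~_0] is
   equality. *)
suff asc i : i <= c -> lower_central (Mlt X) i `<=` acts_trivially (c - i).
  rewrite eqEsubset; split=> [g /asc|_ ->]; last exact: lower_central1.
  by rewrite subnn => /(_ (leqnn c)) g1; apply/symgP/funext => x; exact: g1.
elim: i => [|i IH] ic; first by rewrite subn0.
apply: generated_sub; [exact: acts_trivially1|exact: acts_triviallyB|].
move=> _ [g gi [h Gh <-]].
have Gg : Mlt X g by exact: lower_central_sub gi.
apply: (proj1 (acts_triviallyS _ Gg)) Gh.
by rewrite subnSK //; apply: IH gi; exact: ltnW.
Qed.

Lemma Mlt_acts_trivially j : Mlt X `<=` acts_trivially j <->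
  forall x y, iter_ret_eq j (x ∘ y) y /\ iter_ret_eq j (y • x) y.
Proof.
split=> [G x y|e].
  have [h /G hj hx] := Mlt_Lmap x; have [p /G pj px] := Mlt_Rmap x.
  by have := hj y; have := pj y; rewrite hx px.
apply: generated_sub; [exact: acts_trivially1|exact: acts_triviallyB|].
by move=> g [x [] gx] y; rewrite gx; case: (e x y).
Qed.

Lemma reductive_nilpotent k : 0 < k -> reductive k.+1 X <->
  exists2 j, j <= k & nilpotent_of_class (Mlt X) j.
Proof.
move=> k0; rewrite nilpotent_class_leP lower_central_acts_trivially.
by rewrite Mlt_acts_trivially reductiveP.
Qed.

End Multiplication.

Theorem theorem4p6 (X : biralg) (k : nat) :
  distributive_birack X -> [set: X] !=set0 -> 2 <= k ->
  [<-> [set: iter_ret k X] #= `I_1;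
       reductive k X;
       permutational k X;
       exists2 j : nat, j <= k.-1 & nilpotent_of_class (Mlt X) j].
Proof.
move=> dX X0 k2; have k1 : 0 < k by exact: ltnW.
have nilP : reductive k X <->
    exists2 j : nat, j <= k.-1 & nilpotent_of_class (Mlt X) j.
  by case: k k2 {k1} => // k k1; exact: reductive_nilpotent.
have redP := permutational_reductive dX k2.
have perP := reductive_permutational k1.
(* The cycle passes through (ii) and (iii): [card_iter_ret] ties the cardinality to
   permutationality, and [nilP] ties the class to reductivity. *)
tfae.
- by move/(card_iter_ret k dX X0).
- exact: perP.
- by move=> /redP/nilP.
- by move=> /nilP/perP/(card_iter_ret k dX X0).
Qed.
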